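(* Let $H$ be a $k$-uniform $k$-partite hypergraph with $d_1(H)=d$. There exist a constant $c_k>0$ depending only on $k$ and a constant $C_H$ depending on $H$ such that every $n$-vertex $k$-uniform hypergraph with at least $C_H n^{k-c_k/d^{k-1}}$ edges contains a copy of $H$.
   Context: A hypergraph is $k$-partite if its vertex set can be partitioned into $k$ parts so that each edge has exactly one vertex in each part. The $1$-skeleton $H^{(1)}$ of a $k$-uniform hypergraph $H$ is the graph on $V(H)$ in which two vertices are adjacent iff they lie in a common edge of $H$; the skeletal degeneracy $d_1(H)$ is the degeneracy of $H^{(1)}$, i.e. the least $d$ such that every subgraph of $H^{(1)}$ has minimum degree at most $d$. *)

(* Defs.v *)
From mathcomp Require Import all_boot.
Set Implicit Arguments.
Unset Strict Implicit.
Unset Printing Implicit Defensive.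

(* A hypergraph on the vertex set V is given by its set of edges; every x : V
   is a vertex, so isolated vertices are allowed. *)
Definition hypergraph (V : finType) := {set {set V}}.

Definition uniform (k : nat) (V : finType) (H : hypergraph V) : Prop :=
  forall e, e \in H -> #|e| = k.

(* The k parts are the fibres of f; a part may be empty. *)
Definition partite (k : nat) (V : finType) (H : hypergraph V) : Prop :=
  exists f : V -> 'I_k,
    forall e, e \in H -> forall i : 'I_k, #|[set x in e | f x == i]| = 1.

(* An edge of a graph is a two-element set of vertices. *)
Definition skeleton (V : finType) (H : hypergraph V) : hypergraph V :=
  [set p : {set V} | (#|p| == 2) && [exists e in H, p \subset e]].

(* (S, F) is a subgraph of G; it need not be induced. *)
Definition subgraph (V : finType) (G : hypergraph V)
    (S : {set V}) (F : {set {set V}}) : bool :=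
  (F \subset G) && [forall p in F, p \subset S].

Definition degree (V : finType) (F : {set {set V}}) (x : V) : nat :=
  #|[set p in F | x \in p]|.

Definition min_degree_le (V : finType) (S : {set V}) (F : {set {set V}})
    (d : nat) : bool :=
  [exists x in S, degree F x <= d].

(* The subgraph with no vertex has no minimum degree and is excluded. *)
Definition degeneracy_le (V : finType) (G : hypergraph V) (d : nat) : bool :=
  [forall S : {set V}, forall F : {set {set V}},
    (S != set0) && subgraph G S F ==> min_degree_le S F d].

Lemma degeneracy_le_exists (V : finType) (G : hypergraph V) :
  exists d, degeneracy_le G d.
Proof.
exists #|G|; apply/forallP=> S; apply/forallP=> F; apply/implyP.
case/andP=> /set0Pn[x xS] /andP[/subsetP FG _].
apply/existsP; exists x; rewrite xS /=; apply/subset_leq_card/subsetP=> p.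
by rewrite inE => /andP[/FG].
Qed.

Definition degeneracy (V : finType) (G : hypergraph V) : nat :=
  ex_minn (degeneracy_le_exists G).

Definition skeletal_degeneracy (V : finType) (H : hypergraph V) : nat :=
  degeneracy (skeleton H).

Definition contains_copy (V W : finType) (H : hypergraph V)
    (G : hypergraph W) : Prop :=
  exists f : V -> W, injective f /\ forall e, e \in H -> f @: e \in G.

(* Main.v *)
(* Pick, for each part i, a random s-tuple T_i of vertices of G, with
   s = 2d + 1.  By convexity, applied to one part after the other, all the
   transversals of T_1, ..., T_k are edges of G with probability at least
   p ^ (s ^ k), where p is the density of G.  Embed H greedily so that every edge
   of H whose unembedded vertices are replaced, in all possible ways, by members
   of the tuples of their parts becomes an edge of G.  The next vertex x, in part
   i, has at most d embedded neighbours; given their images and the T_j with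
   j != i, its candidates form a set X that contains T_i, and the choice of x
   can fail only if |X| < |V(H)|.  For fixed images this has probability
   O(n ^ (- s)), since X does not depend on T_i; a union bound over the
   O(n ^ d) possible images gives O(n ^ (d - s)), which is smaller than
   p ^ (s ^ k) when p >= C n ^ (- c / d ^ (k - 1)). *)
Require Import Defs.
From mathcomp Require Import all_boot all_order all_algebra.
From mathcomp Require Import reals exp.
From mathcomp Require Import ring lra.
Import Order.TTheory GRing.Theory Num.Theory.
Local Open Scope ring_scope.

(** * Double counting by overwriting one coordinate *)

(** In terms of probability: replacing one coordinate by an independent uniform value does not
    change the chance of [P]. *)
Lemma card_update {A Y : finType} (get : A -> Y) (put : A -> Y -> A)
    (getK : forall a, put a (get a) = a)
    (putK : forall a y, get (put a y) = y)
    (put2 : forall a y z, put (put a y) z = put a z) (P : pred A) :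
  (#|[set a | P a]| * #|Y| = \sum_a #|[set y | P (put a y)]|)%N.
Proof.
under eq_bigr => a _ do rewrite -sum1dep_card big_mkcond.
rewrite pair_big /= -sum1dep_card big_distrl /=.
under eq_bigr => a _ do rewrite mul1n -sum1_card.
rewrite pair_big_dep big_mkcond /=.
(* Both sides count pairs (a, y); exchanging y with the value stored in a is an
   involution between them. *)
have hK : involutive (fun p : A * Y => (put p.1 p.2, get p.1)).
  by case=> a y /=; rewrite put2 getK putK.
rewrite (reindex_inj (inv_inj hK)) /=.
by apply: eq_bigr => -[a y] _ /=; rewrite andbT.
Qed.

Definition upd {I Y : finType} (T : {ffun I -> Y}) (i : I) (y : Y) :
    {ffun I -> Y} :=
  [ffun j => if j == i then y else T j].

Lemma upd_id (I Y : finType) (T : {ffun I -> Y}) i : upd T i (T i) = T.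
Proof. by apply/ffunP=> j; rewrite ffunE; case: eqP => // ->. Qed.

Lemma updE (I Y : finType) (T : {ffun I -> Y}) i y : upd T i y i = y.
Proof. by rewrite ffunE eqxx. Qed.

Lemma upd_upd (I Y : finType) (T : {ffun I -> Y}) i y z :
  upd (upd T i y) i z = upd T i z.
Proof. by apply/ffunP=> j; rewrite !ffunE; case: eqP. Qed.

Lemma card_ffun_forall {I Y : finType} (P : pred Y) :
  #|[set y : {ffun I -> Y} | [forall a, P (y a)]]| = (#|[set w | P w]| ^ #|I|)%N.
Proof.
rewrite -card_ffun_on; apply: eq_card => y; rewrite !inE.
by apply: eq_forallb => a; rewrite inE.
Qed.

(** * Convexity of powers *)

Section PowerMean.
Variable R : realFieldType.

Lemma tangent_line (s : nat) (x m : R) : 0 <= x -> 0 <= m ->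
  m ^+ s.+1 + s.+1%:R * m ^+ s * (x - m) <= x ^+ s.+1.
Proof.
move=> x0 m0; elim: s => [|s IH]; first by rewrite !expr1 expr0 !mul1r; lra.
rewrite [leRHS]exprS; apply: le_trans (ler_wpM2l x0 IH).
rewrite -subr_ge0.
(* Multiplied by [x], one tangent line exceeds the next by a nonnegative multiple of a square. *)
have -> : x * (m ^+ s.+1 + s.+1%:R * m ^+ s * (x - m)) -
  (m ^+ s.+2 + s.+2%:R * m ^+ s.+1 * (x - m)) =
  s.+1%:R * m ^+ s * (x - m) ^+ 2.
  by rewrite -!natr1 !exprS; ring.
by rewrite mulr_ge0 ?sqr_ge0 // mulr_ge0 ?exprn_ge0.
Qed.

(** Sum the tangent lines at the mean [m]: their linear terms cancel. *)
Lemma power_mean (A : finType) (r : A -> R) (s : nat) :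
  (0 < s)%N -> (forall a, 0 <= r a) ->
  ((\sum_a r a) / #|A|%:R) ^+ s <= (\sum_a r a ^+ s) / #|A|%:R.
Proof.
case: s => // s _ r0; have [A0|A0] := posnP #|A|.
  by rewrite A0 invr0 !mulr0 expr0n.
have A0' : (0 : R) < #|A|%:R by rewrite ltr0n.
set m := _ / _.
have m0 : 0 <= m by rewrite divr_ge0 // sumr_ge0.
rewrite ler_pdivlMr //.
apply: le_trans (_ : \sum_a (m ^+ s.+1 + s.+1%:R * m ^+ s * (r a - m)) <= _).
  rewrite big_split /= -mulr_sumr sumrB !sumr_const.
  have -> : \sum_i r i = m * #|A|%:R by rewrite /m divfK // gt_eqF.
  by rewrite -[m *+ _]mulr_natr subrr mulr0 addr0 mulr_natr.
by apply: ler_sum => a _; apply: tangent_line.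
Qed.

End PowerMean.

(** * Density of the families all of whose transversals satisfy [P] *)

Section Complete.
Variables (R : realFieldType) (k s : nat) (W : finType).
Variable P : pred {ffun 'I_k -> W}.
Hypothesis s_gt0 : (0 < s)%N.

Let family := {ffun 'I_k -> {ffun 'I_s -> W}}.

(* The tuples replace the single vertices of u in the parts of J only, so that J
   can grow one part at a time. *)
Definition mix (J : {set 'I_k}) (u : {ffun 'I_k -> W}) (T : family)
    (a : {ffun 'I_k -> 'I_s}) : {ffun 'I_k -> W} :=
  [ffun j => if j \in J then T j (a j) else u j].

Definition blown_up (J : {set 'I_k}) (p : {ffun 'I_k -> W} * family) : bool :=
  [forall a, P (mix J p.1 p.2 a)].

(** For fixed [u] and [T] the condition on [y] splits into the same condition on each entry, so the
    good [y] number an [s]-th power. *)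
Lemma blown_up_step (J : {set 'I_k}) (i : 'I_k) u (T : family) y : i \notin J ->
  blown_up (i |: J) (u, upd T i y) =
  [forall b, blown_up J (upd u i (y b), T)].
Proof.
move=> iJ; apply/forallP/forallP => [H b|H a].
  apply/forallP=> a; have := H (upd a i b); congr P.
  apply/ffunP=> j; rewrite !ffunE !inE.
  by have [->|] := eqVneq j i; rewrite ?(negPf iJ).
have /forallP/(_ a) := H (a i); congr P.
apply/ffunP=> j; rewrite !ffunE !inE.
by have [->|] := eqVneq j i; rewrite ?(negPf iJ).
Qed.

(** Averaging the proportion of good vertices for part [i] gives the density for [J]; averaging its
    [s]-th power gives the one for [i |: J]. *)
Lemma density_step (J : {set 'I_k}) (i : 'I_k) : i \notin J -> (0 < #|W|)%N ->
  (#|[set p | blown_up J p]|%:R / #|{: {ffun 'I_k -> W} * family}|%:R) ^+ s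
  <= #|[set p | blown_up (i |: J) p]|%:R
     / #|{: {ffun 'I_k -> W} * family}|%:R :> R.
Proof.
move=> iJ W0.
pose r (p : {ffun 'I_k -> W} * family) :=
  #|[set w | blown_up J (upd p.1 i w, p.2)]|.
have W0' : (#|W|%:R : R) != 0 by rewrite pnatr_eq0 -lt0n.
have E1 : \sum_p (r p)%:R / #|W|%:R = #|[set p | blown_up J p]|%:R :> R.
  rewrite -mulr_suml -natr_sum -(card_update
    (fun p : {ffun 'I_k -> W} * family => p.1 i)
    (fun p w => (upd p.1 i w, p.2))) ?natrM ?mulfK //.
  - by case=> u T /=; rewrite upd_id.
  - by move=> p w; rewrite updE.
  - by move=> p w z; rewrite /= upd_upd.
have E2 : \sum_p ((r p)%:R / #|W|%:R) ^+ s
          = #|[set p | blown_up (i |: J) p]|%:R :> R.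
  under eq_bigr => p _ do rewrite expr_div_n -!natrX.
  rewrite -mulr_suml -natr_sum.
  have -> : (\sum_p r p ^ s = \sum_p
     #|[set y | blown_up (i |: J) (p.1, upd p.2 i y)]|)%N.
    apply: eq_bigr => -[u T] _ /=.
    under eq_finset => y do rewrite blown_up_step //.
    by rewrite (card_ffun_forall (fun w => blown_up J (upd u i w, T))) card_ord.
  rewrite -(card_update
    (fun p : {ffun 'I_k -> W} * family => p.2 i)
    (fun p y => (p.1, upd p.2 i y))) /=.
  - by rewrite card_ffun card_ord natrM mulfK // natrX expf_neq0.
  - by case=> u T /=; rewrite upd_id.
  - by move=> p w; rewrite updE.
  - by move=> p w z; rewrite upd_upd.
rewrite -E1 -E2; apply: power_mean => // p.
by rewrite divr_ge0.
Qed.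

Lemma density_blown_up (J : {set 'I_k}) : (0 < #|W|)%N ->
  (#|[set u | P u]|%:R / #|{: {ffun 'I_k -> W}}|%:R) ^+ (s ^ #|J|)
  <= #|[set p | blown_up J p]|%:R
     / #|{: {ffun 'I_k -> W} * family}|%:R :> R.
Proof.
move=> W0; have [m] := ubnP #|J|; elim: m J => // m IH J.
have [->|[i iJ]] := set_0Vmem J.
  move=> _; rewrite cards0 expn0 expr1.
  have -> : [set p | blown_up set0 p] = setX [set u | P u] [set: family].
    apply/setP=> -[u T]; rewrite !inE andbT.
    have mixE a : mix set0 u T a = u by apply/ffunP=> j; rewrite ffunE inE.
    apply/forallP/idP => [/(_ [ffun=> Ordinal s_gt0])|Pu a]; rewrite mixE //.
  rewrite cardsX cardsT card_prod !natrM -mulf_div divff ?mulr1 //.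
  by rewrite pnatr_eq0 -lt0n card_ffun expn_gt0 card_ffun expn_gt0 W0.
rewrite -(setD1K iJ) cardsU1 !inE eqxx add1n ltnS => lt_m.
apply: le_trans (density_step _ _ _ W0); last by rewrite !inE eqxx.
rewrite expnS mulnC exprM; apply: lerXn2r; rewrite ?nnegrE //.
- by rewrite exprn_ge0 // divr_ge0.
- by rewrite divr_ge0.
exact: IH.
Qed.

(** When every part is blown up, [u] has no influence and its factor cancels. *)
Lemma density_complete : (0 < #|W|)%N ->
  (#|[set u | P u]|%:R / #|W|%:R ^+ k) ^+ (s ^ k) * #|{: family}|%:R
  <= #|[set T : family | [forall a : {ffun 'I_k -> 'I_s},
                            P [ffun j => T j (a j)]]]|%:R :> R.
Proof.
move=> W0; have := density_blown_up setT W0.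
have -> : [set p | blown_up setT p] = setX setT [set T : family |
    [forall a : {ffun 'I_k -> 'I_s}, P [ffun j => T j (a j)]]].
  apply/setP=> -[u T]; rewrite !inE /=; apply: eq_forallb => a; congr P.
  by apply/ffunP=> j; rewrite !ffunE inE.
rewrite cardsX !cardsT card_prod !natrM -mulf_div divff ?mul1r; last first.
  by rewrite pnatr_eq0 -lt0n card_ffun expn_gt0 W0.
rewrite !card_ord ler_pdivlMr ?card_ffun ?card_ord ?natrX //.
by rewrite !exprn_gt0 ?ltr0n.
Qed.

End Complete.

(** * Greedy embedding and the count of bad families *)

Section Embedding.
Local Open Scope nat_scope.
Variables (k s : nat) (V W : finType) (H : hypergraph V) (G : hypergraph W).
Variable f : V -> 'I_k.

Let family := {ffun 'I_k -> {ffun 'I_s -> W}}.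

(* B is the set of embedded vertices that matter, phi their images; the value of
   phi outside B is irrelevant. *)
Definition allowed (T : family) (B : {set V}) (phi : {ffun V -> W})
    (y : V) (w : W) : bool :=
  if y \in B then w == phi y else [exists a, w == T (f y) a].

(** Only the values of [g] on [e] matter. Exempting [x] from [allowed] will make the candidates
    independent of the tuple of its part. *)
Definition candidate (T : family) (x : V) (B : {set V}) (phi : {ffun V -> W})
    (w : W) : bool :=
  [forall e in H, (x \in e) ==> [forall g : {ffun V -> W},
    (g x == w) && [forall y in e, (y != x) ==> allowed T B phi y (g y)]
    ==> (g @: e \in G)]].

Definition bad (T : family) (x : V) (B : {set V}) (phi : {ffun V -> W}) :=
  [forall a, candidate T x B phi (T (f x) a)] &&
  (#|[set w | candidate T x B phi w]| < #|V|).

Definition transversals_in_edges (T : family) : bool :=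
  [forall a : {ffun 'I_k -> 'I_s},
     [set [ffun j => T j (a j)] j | j : 'I_k] \in G].

Lemma candidateP T x B phi w :
  reflect (forall e (g : {ffun V -> W}), e \in H -> x \in e -> g x = w ->
             {in e, forall y, y != x -> allowed T B phi y (g y)} ->
           g @: e \in G)
          (candidate T x B phi w).
Proof.
apply: (iffP forall_inP) => [h e g eH xe gx hg|h e eH].
  have /implyP/(_ xe)/forallP/(_ g)/implyP := h e eH; apply.
  by rewrite gx eqxx; apply/forall_inP=> y ye; apply/implyP/hg.
apply/implyP=> xe; apply/forallP=> g; apply/implyP=> /andP[/eqP gx].
by move=> /forall_inP hg; apply: h gx _ => // y ye; apply/implyP/hg.
Qed.

Lemma embed_degenerate (T : family) (w0 : W) (d : nat) :
  (forall e, e \in H -> forall i : 'I_k, #|[set x in e | f x == i]| = 1) ->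
  degeneracy_le (skeleton H) d ->
  transversals_in_edges T ->
  (forall x (B : {set V}) phi, #|B| <= d -> phi \in pffun_on w0 (mem B) predT ->
     ~~ bad T x B phi) ->
  contains_copy H G.
Proof.
move=> fH /forallP degH TG nbad.
(* Invariant: however the vertices outside [S] are filled from their tuples, every edge of [H] goes
   to an edge of [G]. *)
suff: forall S : {set V}, exists phi : {ffun V -> W},
    {in S &, injective phi} /\
    forall e (g : {ffun V -> W}), e \in H ->
      {in e, forall y, allowed T S phi y (g y)} -> g @: e \in G.
  case/(_ setT) => phi [phiI phiG]; exists phi; split=> [x y|e eH].
    by apply: phiI; rewrite inE.
  by apply: phiG => // y _; rewrite /allowed inE.
move=> S; have [m] := ubnP #|S|; elim: m S => // m IH S lt_m.
have [->|S0] := eqVneq S set0.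
  (* Nothing is embedded yet: [g] maps an edge to a transversal of the tuples. *)
  exists [ffun => w0]; split=> [x|e g eH hg]; first by rewrite inE.
  have hx i : {x | (x \in e) && (f x == i)}.
    have := fH e eH i; case: (pickP [pred x in e | f x == i]) => [x xP _|e0].
      by exists x.
    by rewrite (_ : [set x in e | _] = set0) ?cards0 //; apply/setP=> x;
       rewrite !inE; apply: e0.
  have ha i : {a | g (sval (hx i)) == T i a}.
    case: hx => x /= /andP[xe /eqP fx]; apply/sigW/existsP.
    by have := hg x xe; rewrite /allowed inE fx.
  have /forallP/(_ [ffun i => sval (ha i)]) := TG; congr (_ \in G).
  apply/setP=> w; apply/imsetP/imsetP => [[i _ ->]|[x xe ->]].
    exists (sval (hx i)); first by have /andP[] := svalP (hx i).
    by rewrite !ffunE; have /eqP := svalP (ha i).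
  exists (f x) => //; rewrite !ffunE; have /eqP <- := svalP (ha (f x)).
  have /andP[] := svalP (hx (f x)); move: (sval _) => y ye fy; congr (g _).
  have /eqP/cards1P[z ez] := fH e eH (f x).
  have /set1P -> : y \in [set z] by rewrite -ez inE ye fy.
  by apply/set1P; rewrite -ez inE xe eqxx.
(* Degeneracy of the graph induced on [S] yields the vertex to embed last. *)
pose F := [set p in skeleton H | p \subset S].
have /exists_inP[x xS degx] : min_degree_le S F d.
  have /forallP/(_ F)/implyP := degH S; apply; rewrite S0 /subgraph /=.
  apply/andP; split; first by apply/subsetP=> p; rewrite inE => /andP[].
  by apply/forall_inP=> p; rewrite inE => /andP[].
pose B := [set y in S :\ x | [set x; y] \in skeleton H].
have leB : #|B| <= d.
  apply: leq_trans degx; rewrite -(@card_in_imset _ _ (fun y => [set x; y]) B).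
    apply/subset_leq_card/subsetP=> _ /imsetP[y yB ->].
    move: yB; rewrite !inE => /andP[/andP[_ yS] ->]; rewrite eqxx andbT /=.
    by apply/subsetP=> z; rewrite !inE => /orP[] /eqP ->.
  move=> y z; rewrite !inE => /andP[/andP[yx _] _] _ /setP/(_ y).
  by rewrite !inE eqxx orbT (negPf yx) => /esym/eqP.
have [|phi [phiI phiG]] := IH (S :\ x).
  by move: lt_m; rewrite (cardsD1 x S) xS.
(* The default [w0] off [B] keeps the number of maps in the union bound at [#|W| ^ #|B|]. *)
pose phiB : {ffun V -> W} := [ffun y => if y \in B then phi y else w0].
(* The other embedded vertices of an edge through [x] are its skeleton neighbours, so they lie in
   [B]. *)
have sameB e y w : e \in H -> x \in e -> y \in e -> y != x ->
    allowed T B phiB y w = allowed T (S :\ x) phi y w.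
  move=> eH xe ye yx; rewrite /allowed.
  have yB : (y \in B) = (y \in S :\ x).
    rewrite !inE yx /=; case: (y \in S) => //=.
    rewrite cards2 (eq_sym x) yx /=; apply/exists_inP; exists e => //.
    by apply/subsetP=> z; rewrite !inE => /orP[] /eqP ->.
  by rewrite yB; case: ifP => // yS; rewrite ffunE yB yS.
have : ~~ bad T x B phiB.
  apply: nbad => //; apply/pffun_onP; split=> [|w _]; last by rewrite inE.
  by apply/subsetP=> y; apply: contraTT => yB; rewrite inE ffunE (negPf yB) eqxx.
(* By the invariant for [S :\ x] the whole tuple of [x] consists of candidates, so there must be at
   least [#|V|] candidates. *)
rewrite negb_and => /orP[/forallPn[a /negP[]]|].
  apply/candidateP=> e g eH xe gx hg; apply: phiG => // y ye.
  have [->|yx] := eqVneq y x; last by rewrite -(sameB e) ?hg.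
  by rewrite /allowed !inE eqxx /= gx; apply/existsP; exists a.
rewrite -leqNgt => leX.
(* Fewer than [#|V|] images are taken, so some candidate is free. *)
have [w wX wS] : exists2 w, candidate T x B phiB w & w \notin phi @: (S :\ x).
  have : ~~ ([set w | candidate T x B phiB w] \subset phi @: (S :\ x)).
    apply/negP=> /subset_leq_card le1.
    have := leq_trans leX (leq_trans le1 (leq_imset_card _ _)).
    rewrite leqNgt (leq_trans _ (max_card (mem S))) //.
    by rewrite (cardsD1 x S) xS.
  by case/subsetPn=> w; rewrite inE; exists w.
exists (upd phi x w); split.
  have phiw y : y \in S -> y != x -> phi y != w.
    move=> yS yx; apply: contraNneq wS => <-; apply: imset_f.
    by rewrite !inE yx.
  move=> y z yS zS; rewrite !ffunE.
  have [->|yx] := eqVneq y x; have [->|zx] := eqVneq z x => //.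
  - by move/esym/eqP; rewrite (negPf (phiw z zS zx)).
  - by move/eqP; rewrite (negPf (phiw y yS yx)).
  by apply: phiI; rewrite !inE ?yx ?zx.
move=> e g eH hg; have hg' y : y \in e -> y != x ->
    allowed T (S :\ x) phi y (g y).
  move=> ye yx; have := hg y ye.
  by rewrite /allowed !inE ffunE (negPf yx).
have [xe|xe] := boolP (x \in e); last first.
  by apply: phiG => // y ye; apply: hg' => //; apply: contraNneq xe => <-.
move/candidateP: wX; apply=> //.
  by have := hg x xe; rewrite /allowed xS updE => /eqP.
by move=> y ye yx; rewrite (sameB e) ?hg'.
Qed.

(** An edge through [x] has no other vertex in the part of [x], so the tuple of that part is never
    consulted. *)
Lemma candidate_upd T x B phi z :
  (forall e, e \in H -> forall i : 'I_k, #|[set x in e | f x == i]| = 1) ->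
  candidate (upd T (f x) z) x B phi =1 candidate T x B phi.
Proof.
move=> fH w; apply: eq_forallb => e; case: (boolP (e \in H)) => //= eH.
case: (boolP (x \in e)) => //= xe; apply: eq_forallb => g; congr (_ && _ ==> _).
apply: eq_forallb => y; case: (boolP (y \in e)) => //= ye.
have [//|/= yx] := eqVneq y x; rewrite /allowed ffunE; case: (f y =P f x) => // fyx.
have /eqP/cards1P[u eu] := fH e eH (f x); case/eqP: yx.
have /set1P -> : y \in [set u] by rewrite -eu inE ye fyx eqxx.
have /set1P -> // : x \in [set u] by rewrite -eu inE xe eqxx.
Qed.

(** With the other tuples fixed the candidate set is fixed; a bad tuple lies inside it, and only
    sets smaller than [#|V|] count. *)
Lemma card_bad x B phi :
  (forall e, e \in H -> forall i : 'I_k, #|[set x in e | f x == i]| = 1) ->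
  #|[set T | bad T x B phi]| * #|W| ^ s <= #|{: family}| * #|V| ^ s.
Proof.
move=> fH; have -> : #|W| ^ s = #|{: {ffun 'I_s -> W}}| by rewrite card_ffun card_ord.
rewrite (card_update (fun T : family => T (f x)) (fun T y => upd T (f x) y));
  [|by move=> *; rewrite upd_id|by move=> *; rewrite updE|
   by move=> *; rewrite upd_upd].
rewrite -sum_nat_const; apply: leq_sum => T _.
have cardE y : #|[set w | candidate (upd T (f x) y) x B phi w]| =
    #|[set w | candidate T x B phi w]|.
  by apply: eq_card => w; rewrite !inE candidate_upd.
under eq_finset => y do rewrite /bad cardE.
have [lt|_] := ltnP #|[set w | candidate T x B phi w]| #|V|; last first.
  by rewrite (_ : [set _ | _] = set0) ?cards0 //; apply/setP=> y;
     rewrite !inE andbF.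
have := card_ffun_forall (I := 'I_s) (candidate T x B phi).
rewrite card_ord => cardX.
rewrite (eq_card (_ : _ =i [set y : {ffun 'I_s -> W} |
  [forall a, candidate T x B phi (y a)]])) ?cardX => [|y].
  by case: (s) => [//|s']; rewrite leq_exp2r // ltnW.
rewrite !inE andbT; apply: eq_forallb => a.
by rewrite updE candidate_upd.
Qed.

(* Maps equal to w0 outside B represent the partial maps with domain B. *)
Definition admissible (w0 : W) (d : nat) :=
  [set q : V * ({set V} * {ffun V -> W}) |
    (#|q.2.1| <= d) && (q.2.2 \in pffun_on w0 (mem q.2.1) predT)].

Lemma card_admissible w0 d :
  #|admissible w0 d| <= #|V| * (2 ^ #|V| * #|W| ^ d).
Proof.
have W0 : 0 < #|W| by apply/card_gt0P; exists w0.
rewrite -sum1dep_card.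
rewrite -(pair_big_dep xpredT (fun _ (q : {set V} * {ffun V -> W}) =>
  (#|q.1| <= d) && (q.2 \in pffun_on w0 (mem q.1) predT)) (fun _ _ => 1)) /=.
rewrite sum_nat_const leq_mul2l; apply/orP; right.
rewrite -(pair_big_dep (fun B : {set V} => #|B| <= d)
  (fun B phi => phi \in pffun_on w0 (mem B) predT) (fun _ _ => 1)) /=.
rewrite -cardsT -card_powerset powersetT -sum_nat_const.
rewrite [leqLHS]big_mkcond /= [leqRHS](eq_bigl predT) => [|B]; last by rewrite inE.
apply: leq_sum => B _; case: ifP => // leB.
rewrite sum1_card card_pffun_on (eq_card (_ : predT =i W)) //.
by rewrite leq_pexp2l.
Qed.

Lemma card_bad_union w0 d :
  (forall e, e \in H -> forall i : 'I_k, #|[set x in e | f x == i]| = 1) ->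
  #|\bigcup_(q in admissible w0 d) [set T | bad T q.1 q.2.1 q.2.2]| * #|W| ^ s
  <= #|V| * (2 ^ #|V| * #|W| ^ d) * (#|{: family}| * #|V| ^ s).
Proof.
move=> fH; apply: leq_trans (leq_mul (card_admissible w0 d) (leqnn _)).
rewrite -[leqRHS]sum_nat_const.
apply: leq_trans (_ : \sum_(q in admissible w0 d)
  #|[set T | bad T q.1 q.2.1 q.2.2]| * #|W| ^ s <= _); last first.
  by apply: leq_sum => q _; apply: card_bad.
rewrite -big_distrl /= leq_mul2r; apply/orP; right.
elim/big_rec2: _ => [|q A m _ leA]; first by rewrite cards0.
by rewrite (leq_trans (leq_card_setU _ _)) ?leq_add2l.
Qed.

End Embedding.

(** * From edge counts to densities and exponents *)

Lemma card_edge_enumerations (k : nat) (W : finType) (G : hypergraph W) :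
  uniform k G ->
  (#|G| <= #|[set u : {ffun 'I_k -> W} | [set u j | j : 'I_k] \in G]|)%N.
Proof.
move=> Gk; set E := [set u | _].
apply: leq_trans (leq_imset_card (fun u : {ffun 'I_k -> W} =>
  [set u j | j : 'I_k]) E).
apply/subset_leq_card/subsetP=> e eG; apply/imsetP.
have ek := Gk e eG.
pose u : {ffun 'I_k -> W} := [ffun j => enum_val (cast_ord (esym ek) j)].
have ue : [set u j | j : 'I_k] = e.
  apply/setP=> w; apply/imsetP/idP => [[j _ ->]|we].
    by rewrite ffunE enum_valP.
  exists (cast_ord ek (enum_rank_in we w)) => //.
  by rewrite ffunE cast_ordK enum_rankK_in.
by exists u; rewrite ?inE ue.
Qed.

(** For positive [d], use [2d + 1 <= 3d]; the powers of 3 cancel and [d] is left. *)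
Lemma exponent_le (R : realFieldType) (k d : nat) : (0 < k)%N ->
  3%:R ^- k / d%:R ^+ k.-1 * (d.*2.+1 ^ k)%:R <= d.+1%:R :> R.
Proof.
case: k => // k _ /=; have [->|d0] := posnP d.
  (* Here [0 ^+ k] is 1 or 0, and the inverse of 0 is 0. *)
  rewrite double0 exp1n mulr1 expr0n -exprVn.
  have le1 : (3%:R^-1 : R) ^+ k.+1 <= 1.
    by rewrite exprn_ile1 ?invr_ge0 ?invf_le1 ?ler1n ?ltr0n.
  case: eqP => _; first by rewrite invr1 mulr1.
  by rewrite invr0 mulr0 ler01.
have d0' : 0 < d%:R :> R by rewrite ltr0n.
apply: (@le_trans _ _ (3%:R ^- k.+1 / d%:R ^+ k * ((3 * d) ^ k.+1)%:R)).
  rewrite ler_wpM2l ?mulr_ge0 ?invr_ge0 ?exprn_ge0 //.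
  by rewrite ler_nat leq_exp2r // mulSn mul2n addnC -addn1 leq_add2l.
rewrite natrX natrM exprMn.
have -> : 3%:R ^- k.+1 / d%:R ^+ k * (3%:R ^+ k.+1 * d%:R ^+ k.+1) = d%:R :> R.
  rewrite mulrACA mulVf ?mul1r ?expf_neq0 ?pnatr_eq0 //.
  by rewrite exprSr mulKf // expf_neq0 // gt_eqF.
by rewrite ler_nat.
Qed.

(** The density is at least [C N^(-e)]; in its [m]-th power use [C^m >= C] and [e m <= d]. *)
Lemma density_power_ge (R : realType) (C N e g : R) (k d m : nat) :
  1 <= C -> 1 <= N -> (0 < m)%N -> e * m%:R <= d%:R ->
  C * N `^ (k%:R - e) <= g -> C / N ^+ d <= (g / N ^+ k) ^+ m.
Proof.
move=> C1 N1 m0 em Cg.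
have N0 : 0 < N by apply: lt_le_trans N1.
have C0 : 0 <= C by apply: le_trans C1.
apply: (@le_trans _ _ ((C * N `^ (- e)) ^+ m)).
  rewrite exprMn; apply: ler_pM => //; first by rewrite invr_ge0 exprn_ge0 // ltW.
    by rewrite ler_eXnr.
  rewrite -powR_invn ?(ltW N0) // -powR_mulrn ?powR_ge0 // -powRrM.
  by rewrite ler_powR // mulNr lerN2.
have g0 : 0 <= g by apply: le_trans Cg; rewrite mulr_ge0 ?powR_ge0.
apply: lerXn2r; rewrite ?nnegrE.
- by rewrite mulr_ge0 ?powR_ge0.
- by rewrite divr_ge0 ?exprn_ge0 ?(ltW N0).
rewrite ler_pdivlMr ?exprn_gt0 // -mulrA -powR_mulrn ?(ltW N0) // -powRD.
  by rewrite addrC.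
by rewrite (gt_eqF N0) /= implybT.
Qed.

(** * Choice of the constants and comparison of the two counts *)

Theorem theorem2p5 (R : realType) (k : nat) (k_gt0 : (0 < k)%N) :
  exists2 c : R, 0 < c &
    forall (V : finType) (H : hypergraph V) (d : nat),
      uniform k H -> partite k H -> skeletal_degeneracy H = d ->
      exists C : R,
        forall (n : nat) (W : finType) (G : hypergraph W),
          (0 < n)%N -> #|W| = n -> uniform k G ->
          C * n%:R `^ (k%:R - c / d%:R ^+ k.-1) <= #|G|%:R ->
          contains_copy H G.
Proof.
exists (3%:R ^- k); first by rewrite invr_gt0 exprn_gt0 ?ltr0n.
move=> V H d _ [f fH] degH; pose s := d.*2.+1.
have degH' : degeneracy_le (skeleton H) d.
  by rewrite -degH /skeletal_degeneracy /degeneracy; case: ex_minnP.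
(* [K] is the constant of the union bound; [K.+1] makes the comparison strict. *)
pose K := (#|V| * 2 ^ #|V| * #|V| ^ s)%N.
exists K.+1%:R => n W G n0 Wn Gk GC.
have W0 : (0 < #|W|)%N by rewrite Wn.
have /card_gt0P[w0 _] := W0.
pose family := {ffun 'I_k -> {ffun 'I_s -> W}}.
pose complete := [set T : family | transversals_in_edges k s W G T].
pose bads := \bigcup_(q in admissible V W w0 d)
  [set T : family | bad k s V W H G f T q.1 q.2.1 q.2.2].
have N0 : 0 < n%:R :> R by rewrite ltr0n.
have F0 : 0 < #|{: family}|%:R :> R by rewrite ltr0n !card_ffun !expn_gt0 W0.
have le_complete :
    K.+1%:R / n%:R ^+ d.+1 * #|{: family}|%:R <= #|complete|%:R :> R.
  apply: le_trans (density_complete R k s W (fun u : {ffun 'I_k -> W} =>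
    [set u j | j : 'I_k] \in G) _ W0) => //.
  rewrite ler_wpM2r ?(ltW F0) // Wn.
  apply: (density_power_ge R _ _ (3%:R ^- k / d%:R ^+ k.-1) _ k).
  - by rewrite ler1n.
  - by rewrite ler1n.
  - by rewrite expn_gt0.
  - exact: exponent_le.
  - apply: le_trans GC _; rewrite ler_nat; exact: card_edge_enumerations.
have le_bads : #|bads|%:R * n%:R ^+ s
    <= K%:R * n%:R ^+ d * #|{: family}|%:R :> R.
  have := card_bad_union k s V W H G f w0 d fH.
  rewrite Wn -(ler_nat R) !natrM !natrX => /le_trans; apply.
  by rewrite le_eqVlt; apply/orP; left; apply/eqP; ring.
have [T TG Tbad] : exists2 T, T \in complete & T \notin bads.
  apply/subsetPn/negP=> /subset_leq_card; rewrite -(ler_nat R) => le_cb.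
  have := le_trans (ler_wpM2r (exprn_ge0 s (ltW N0))
    (le_trans le_complete le_cb)) le_bads.
  (* Since [s = d.+1 + d], cancelling the powers of [n] leaves [K.+1 <= K]. *)
  rewrite mulrAC ler_pM2r // /s -addnn -addSn exprD mulrA divfK; last first.
    by rewrite expf_neq0 // gt_eqF.
  by rewrite ler_pM2r ?exprn_gt0 // ler_nat ltnn.
apply: (embed_degenerate k s V W H G f T w0 d fH degH') => [|x B phi leB phiB].
  by rewrite inE in TG.
apply: contra Tbad => badT; apply/bigcupP; exists (x, (B, phi)).
  by rewrite inE /= leB.
by rewrite inE.
Qed.
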